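(* Let $d\ge 1$ and $m>n\ge 1$ be integers. Let $\overline{f}(d,n,m)$ be the minimum number of sets in an antipodal $\overline{(n,m)}$-fold cover of $S^d$ with open sets. Then $\overline{f}(d,n,m)=d+2m-1$.
   Context: $S^d$ denotes the $d$-dimensional unit sphere in $\mathbb{R}^{d+1}$ centered at the origin. A cover of $S^d$ is a (finite) family of subsets of $S^d$ whose union is $S^d$; it is an $n$-fold cover if every point of $S^d$ belongs to at least $n$ of the sets. A cover is antipodal if none of its sets contains a pair of antipodal points $x,-x$. The closed northern hemisphere is $\{x\in S^d : x_{d+1}\ge 0\}$. For $m>n\ge1$, an $\overline{(n,m)}$-fold cover of $S^d$ is an $n$-fold cover of $S^d$ in which every point of the closed northern hemisphere belongs to at least $m$ of the sets. *)

(* Defs.v *)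
From HB Require Import structures.
From mathcomp Require Import all_boot all_order all_algebra.
From mathcomp Require Import all_classical all_reals topology normedtype.
Set Implicit Arguments. Unset Strict Implicit. Unset Printing Implicit Defensive.
Import Order.TTheory GRing.Theory Num.Theory.
Import numFieldNormedType.Exports.
Local Open Scope classical_set_scope.
Local Open Scope ring_scope.

(* Points of R^(d+1) are row vectors 'rV[R]_(d.+1) (normed space, sup norm,
   whose topology is the usual Euclidean topology). *)

Definition sphere (R : realType) (d : nat) : set 'rV[R]_(d.+1) :=
  [set x | \sum_(i < d.+1) (x ord0 i) ^+ 2 = 1].

Definition north_hemisphere (R : realType) (d : nat) : set 'rV[R]_(d.+1) :=
  [set x | @sphere R d x /\ 0 <= x ord0 ord_max].

Definition open_in_sphere (R : realType) (d : nat) (A : set 'rV[R]_(d.+1)) :=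
  exists U : set 'rV[R]_(d.+1), open U /\ A = U `&` @sphere R d.

Definition mult (R : realType) (d k : nat) (F : 'I_k -> set 'rV[R]_(d.+1))
  (x : 'rV[R]_(d.+1)) : nat := #|[set i : 'I_k | `[< F i x >]]|.

Definition antipodal_nm_open_cover (R : realType) (d n m k : nat)
  (F : 'I_k -> set 'rV[R]_(d.+1)) : Prop :=
  [/\ (forall i, open_in_sphere (F i)),
      (forall i, F i `<=` @sphere R d),
      (forall i x, F i x -> ~ F i (- x)),
      (forall x, @sphere R d x -> (n <= mult F x)%N) &
      (forall x, @north_hemisphere R d x -> (m <= mult F x)%N)].

(* Main.v *)
(* Lower bound. On the equator S^D, D = d - 1, the sets form an m-fold cover by open antipodal sets,
   so it is enough that such a cover has at least D + 2m members. Send a cell c of a fine cubical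
   subdivision of the boundary of a (D+1)-cube to the pair (X(c), X(-c)), where X(c) collects the
   sets containing the whole (radially projected) cell, and give c a sign by an antipodal choice
   depending on this pair only. A mod 2 count of the flags of cells along which the sign alternates
   (a form of Ky Fan's lemma) yields such a flag with D + 1 members; along it |X(c)| + |X(-c)| <= k
   drops at least D times and never below 2m.

   Upper bound. Read a point of S^d as a polynomial p of degree at most d with p(0) equal to the last
   coordinate. By Gale's lemma, (-1)^(i+1) p(i) is positive for at least m of the integers
   0 <= i < d + 2m. The sets are given by these conditions for i >= 1; the omitted condition i = 0
   fails on the closed northern hemisphere. *)
Require Import Defs.
From mathcomp Require Import all_boot all_order all_algebra.
From mathcomp Require Import all_classical all_reals topology normedtype.
From mathcomp Require Import realfun.
From mathcomp Require Import zify ring lra.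
Set Implicit Arguments. Unset Strict Implicit. Unset Printing Implicit Defensive.
Import Order.TTheory GRing.Theory Num.Theory.
Import numFieldNormedType.Exports.
Local Open Scope classical_set_scope.
Local Open Scope ring_scope.

(** * Alternating flags of a cubical grid *)

Lemma F2_addrr (x : 'F_2) : x + x = 0.
Proof. by apply: addrr_pchar2; apply: pchar_Fp. Qed.

Lemma F2_addb (a b : bool) : (a (+) b)%:R = a%:R + b%:R :> 'F_2.
Proof. by case: a b => [] [] //=; rewrite ?F2_addrr ?addr0 ?add0r. Qed.

(** The terms at [(p, q)] and [(q, p)] cancel in characteristic 2. *)
Lemma F2_sum_sym (I : finType) (G : I -> I -> 'F_2) :
  (forall p q, G p q = G q p) -> (forall p, G p p = 0) ->
  \sum_p \sum_q G p q = 0.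
Proof.
move=> Gsym Gdiag; rewrite pair_big /=.
pose lt (u : I * I) := (enum_rank u.1 < enum_rank u.2)%N.
rewrite (bigID lt) /= [X in _ + X](bigID (fun u => u.1 == u.2)) /=.
rewrite [X in _ + (X + _)]big1 ?add0r; last first.
  by case=> p q /= /andP[_ /eqP->].
rewrite [X in _ + X](reindex_inj (h := fun u => (u.2, u.1))) /=; last first.
  by move=> [a b] [c d] /= [-> ->].
rewrite [X in _ + X](eq_bigl lt) => [|[p q]]; last first.
  rewrite /lt /=; case: (eqVneq q p) => [->|neq]; first by rewrite ltnn.
  have: enum_rank p != enum_rank q by rewrite (inj_eq enum_rank_inj) eq_sym.
  by rewrite -(inj_eq val_inj) /= andbT -leqNgt leq_eqVlt => /negPf->.
by rewrite [X in _ + X](eq_bigr (fun u => G u.1 u.2)) ?F2_addrr // => -[p q].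
Qed.

Section Grid.
Variables (n M : nat).
Notation coord := 'I_(M + M).+1.
Notation cell := {ffun 'I_n -> coord}.

(* The even elements of [coord] are the vertices of a subdivided segment with centre [M], the odd
   ones its edges; a cell of the grid is a product of such vertices and edges. *)
Definition inc (u v : coord) : 'F_2 :=
  (odd v && ((u == v.+1 :> nat) || (v == u.+1 :> nat)))%:R.

(** The boundary matrix modulo 2: [inc u v = 1] forces [u != v], so at most one direction [p]
    contributes. *)
Definition face (b c : cell) : 'F_2 :=
  \sum_p \prod_i (if i == p then inc (b i) (c i) else (b i == c i)%:R).

Lemma sum_ord_delta (K : nat) (f : 'I_K -> 'F_2) w :
  \sum_(v < K) (v == w)%:R * f v = f w.
Proof.
by rewrite (bigD1 w) //= eqxx mul1r big1 ?addr0 // => v /negPf->; rewrite mul0r.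
Qed.

Lemma inc_sum (w : coord) : \sum_v inc v w = 0.
Proof.
rewrite /inc; case: (boolP (odd w)) => ow; last by rewrite big1.
have w1 : (w.-1 < (M + M).+1)%N by have := ltn_ord w; lia.
have w2 : (w.+1 < (M + M).+1)%N by have := ltn_ord w; lia.
rewrite (eq_bigr (fun v => (v == Ordinal w1)%:R * 1 + (v == Ordinal w2)%:R * 1)).
  by rewrite big_split /= !sum_ord_delta F2_addrr.
move=> v _; rewrite !mulr1 -F2_addb; congr (nat_of_bool _)%:R.
rewrite -!(inj_eq val_inj) /=; apply/idP/idP; lia.
Qed.

Lemma face_sum c : \sum_b face b c = 0.
Proof.
rewrite /face exchange_big big1 //= => p _.
rewrite -(bigA_distr_bigA (fun i v => if i == p then inc v (c i) else (v == c i)%:R)).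
by rewrite (bigD1 p) //= eqxx inc_sum mul0r.
Qed.

(** Boundary of a boundary. Expanding gives a sum over pairs of directions, symmetric in the pair;
    the diagonal vanishes because the ends of an edge are vertices, which have no ends. *)
Lemma face_face a c : \sum_b face a b * face b c = 0.
Proof.
pose g p q i v := (if i == p then inc (a i) v else (a i == v)%:R) *
                  (if i == q then inc v (c i) else (v == c i)%:R).
pose G p q := \prod_i \sum_v g p q i v.
transitivity (\sum_p \sum_q G p q).
  under eq_bigr do rewrite /face big_distrlr /=.
  rewrite exchange_big; apply: eq_bigr => p _ /=.
  rewrite exchange_big; apply: eq_bigr => q _ /=.
  rewrite /G (bigA_distr_bigA (g p q)) /=.
  by apply: eq_bigr => b _; rewrite -big_split.
have delta_l w (f : coord -> 'F_2) : \sum_v (w == v)%:R * f v = f w.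
  by under eq_bigr do rewrite eq_sym; rewrite sum_ord_delta.
have delta_r w (f : coord -> 'F_2) : \sum_v f v * (v == w)%:R = f w.
  by under eq_bigr do rewrite mulrC; rewrite sum_ord_delta.
have gE p q i : p != q -> \sum_v g p q i v =
    if (i == p) || (i == q) then inc (a i) (c i) else (a i == c i)%:R.
  rewrite /g; case: (eqVneq i p) => [->|ip] /=.
    by move=> /negPf ->; rewrite delta_r.
  by case: (eqVneq i q) => [->|iq] _; rewrite delta_l.
apply: F2_sum_sym => [p q|p].
  case: (eqVneq p q) => [->//|pq]; apply: eq_bigr => i _.
  by rewrite (gE p q i pq) (gE q p i) 1?eq_sym // orbC.
rewrite /G (bigD1 p) //= [X in X * _]big1 ?mul0r // => v _.
rewrite /g eqxx /inc -natrM mulnb.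
by rewrite [_ && _](_ : _ = false) //; apply/negP; lia.
Qed.

(** * Alternating flags as cochains modulo 2 *)

Section Flags.
Variable s : cell -> bool.

(* [flag j c] counts, modulo 2, the chains of faces [c_0 < ... < c_j = c] of
   codimension one along which the sign [s] alternates. *)
Fixpoint flag j c : 'F_2 :=
  if j is j'.+1 then \sum_b face b c * ((s b (+) s c)%:R * flag j' b) else 1.

(** In cochain terms, [flag s j] is a cocycle and [flag s j.+1] is the coboundary of [s] times
    [flag s j]. The cocycle condition removes the contribution of [s c]; conversely a coboundary is
    a cocycle by [face_face]. *)
Lemma flag_face j :
  (forall c, \sum_b face b c * flag j b = 0) /\
  (forall c, flag j.+1 c = \sum_b face b c * ((s b)%:R * flag j b)).
Proof.
have step i : (forall c, \sum_b face b c * flag i b = 0) ->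
    forall c, flag i.+1 c = \sum_b face b c * ((s b)%:R * flag i b).
  move=> flag0 c; have := congr1 ( *%R (s c)%:R) (flag0 c).
  rewrite mulr0 mulr_sumr => flag0c.
  rewrite -[RHS]addr0 -[X in _ = _ + X]flag0c -big_split; apply: eq_bigr => b _ /=.
  by rewrite F2_addb mulrDl mulrDr [in X in _ + X]mulrCA.
elim: j => [|j [_ flagS]].
  have flag0 c : \sum_b face b c * flag 0 b = 0.
    by under eq_bigr do rewrite mulr1; exact: face_sum.
  by split=> //; apply: step.
have flag0 c : \sum_b face b c * flag j.+1 b = 0.
  under eq_bigr do rewrite flagS mulr_sumr.
  rewrite exchange_big big1 //= => a _.
  under eq_bigr do rewrite mulrA [face _ c * _]mulrC.
  by rewrite -mulr_suml face_face mul0r.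
by split=> //; apply: step.
Qed.

End Flags.

Definition neg (c : cell) : cell := [ffun i => rev_ord (c i)].

Lemma negK : involutive neg.
Proof. by move=> c; apply/ffunP => i; rewrite !ffunE rev_ordK. Qed.

Lemma inc_rev (u v : coord) : inc (rev_ord u) (rev_ord v) = inc u v.
Proof.
rewrite /inc /=; congr (nat_of_bool _)%:R.
by have := (ltn_ord u, ltn_ord v); case=> ? ?; apply/idP/idP; lia.
Qed.

Lemma face_neg b c : face (neg b) (neg c) = face b c.
Proof.
apply: eq_bigr => p _; apply: eq_bigr => i _.
by rewrite !ffunE inc_rev (inj_eq rev_ord_inj).
Qed.

(** * Boundaries of cubes and half-cubes *)

Definition edges (lo hi : nat) (v : coord) : 'F_2 := (odd v && (lo < v < hi)%N)%:R.
Definition vertex (lo : nat) (v : coord) : 'F_2 := (v == lo :> nat)%:R.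

(** A vertex strictly inside the segment ends two of its edges, which cancel. *)
Lemma edges_inc lo hi (u : coord) : ~~ odd lo -> ~~ odd hi -> (lo <= hi <= M + M)%N ->
  \sum_v edges lo hi v * inc u v = vertex lo u + vertex hi u.
Proof.
move=> elo ehi /andP[lohi hiM]; rewrite /edges /inc /vertex.
under eq_bigr do rewrite -natrM mulnb.
have := ltn_ord u => uK.
case: (boolP (odd u)) => ou.
  rewrite big1 => [|v _]; last by rewrite [_ && _](_ : _ = false) //; apply/negP; lia.
  by rewrite -F2_addb [_ (+) _](_ : _ = false) //; apply/negP; lia.
(* [v1] and [v2] are the edges on the two sides of [u]. Their values at [u = 0] and for [u >= hi]
   are arbitrary: the conditions on [u] below switch them off. *)
have [v1 v1E] : exists v1 : coord, v1 = u.-1 :> nat.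
  have u1 : (u.-1 < (M + M).+1)%N by lia.
  by exists (Ordinal u1).
have [v2 v2E] : exists v2 : coord, v2 = (if (u < hi)%N then u.+1 else u) :> nat.
  have u2 : ((if (u < hi) then u.+1 else u) < (M + M).+1)%N by case: ifP; lia.
  by exists (Ordinal u2).
rewrite (eq_bigr (fun v => (v == v1)%:R * (lo < u <= hi)%N%:R +
                            (v == v2)%:R * (lo <= u < hi)%N%:R)).
  rewrite big_split /= !sum_ord_delta -!F2_addb; congr (nat_of_bool _)%:R.
  by apply/idP/idP; lia.
move=> v _; rewrite -!natrM !mulnb -F2_addb; congr (nat_of_bool _)%:R.
by rewrite -!(inj_eq val_inj) /= v1E v2E; case: ifP => ?; apply/idP/idP; lia.
Qed.

(** The Leibniz rule for the boundary of a product of chains. *)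
Lemma box_boundary (t : 'I_n -> coord -> 'F_2) b :
  \sum_(c : cell) (\prod_i t i (c i)) * face b c =
  \sum_p \prod_i (if i == p then \sum_v t i v * inc (b i) v else t i (b i)).
Proof.
under eq_bigr do rewrite mulr_sumr.
rewrite exchange_big; apply: eq_bigr => p _ /=.
pose f i v := t i v * (if i == p then inc (b i) v else (b i == v)%:R).
under eq_bigr do rewrite -big_split /=.
rewrite -(bigA_distr_bigA f) /f; apply: eq_bigr => i _ /=.
case: eqP => // _; under eq_bigr do rewrite mulrC eq_sym.
by rewrite sum_ord_delta.
Qed.

(** Chains through the centre: [cube j] spans the first [j] directions, and [half_cube j] is the
    upper half, in direction [j], of [cube j.+1]. *)
Definition side j (i : 'I_n) (v : coord) : 'F_2 :=
  if (i < j)%N then edges 0 (M + M) v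
  else if i == j :> nat then edges M (M + M) v else vertex M v.

Definition cube j (c : cell) : 'F_2 :=
  \prod_(i : 'I_n) (if (i < j)%N then edges 0 (M + M) (c i) else vertex M (c i)).

Definition half_cube j (c : cell) : 'F_2 := \prod_i side j i (c i).

(* The part of the boundary of [half_cube j] which is not in [cube j]. *)
Definition cap j (c : cell) : 'F_2 :=
  \sum_(p : 'I_n | (p <= j)%N) \prod_(i : 'I_n)
    (if i == p then (if (i < j)%N then vertex 0 (c i) else 0) + vertex (M + M) (c i)
     else side j i (c i)).

Lemma edges_rev lo hi v : (hi <= M + M)%N ->
  edges lo hi (rev_ord v) = edges (M + M - hi) (M + M - lo) v.
Proof.
move=> hiM; rewrite /edges /=; congr (nat_of_bool _)%:R.
by have := ltn_ord v => ?; apply/idP/idP; lia.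
Qed.

Lemma vertex_rev lo v : (lo <= M + M)%N -> vertex lo (rev_ord v) = vertex (M + M - lo) v.
Proof.
move=> loM; rewrite /vertex /=; congr (nat_of_bool _)%:R.
by have := ltn_ord v => ?; apply/idP/idP; lia.
Qed.

Definition boundary_cell (c : cell) := [exists p, (c p == 0 :> nat) || (c p == (M + M)%N :> nat)].

Definition subcell (b c : cell) := [forall i, (b i == c i) ||
  (odd (c i) && ((b i == (c i).+1 :> nat) || (c i == (b i).+1 :> nat)))].

Lemma face_subcell b c : face b c != 0 -> subcell b c.
Proof.
apply: contraR => /forallPn[i]; rewrite negb_or => /andP[bci nci].
rewrite /face big1 // => p _; rewrite (bigD1 i) //= (negPf bci) /inc (negPf nci).
by rewrite if_same mul0r.
Qed.

Lemma subcell_boundary b c : subcell b c -> boundary_cell c -> boundary_cell b.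
Proof.
move=> /forallP bc /existsP[p cp]; apply/existsP; exists p.
by case/orP: (bc p) => [/eqP->//|]; lia.
Qed.

Lemma boundary_neg c : boundary_cell (neg c) = boundary_cell c.
Proof.
have bdN d : boundary_cell d -> boundary_cell (neg d).
  by case/existsP=> p dp; apply/existsP; exists p; rewrite ffunE /=; lia.
by apply/idP/idP => /bdN //; rewrite negK.
Qed.

Lemma cap_boundary j c : cap j c != 0 -> boundary_cell c.
Proof.
apply: contraR; rewrite negb_exists => /forallP nbd.
rewrite /cap big1 // => p _; rewrite (bigD1 p) //= eqxx.
have:= nbd p; rewrite negb_or /vertex => /andP[/negPf-> /negPf->].
by rewrite if_same addr0 mul0r.
Qed.

Hypothesis evenM : ~~ odd M.

(** Directions after [j] sit at [M], a vertex since [M] is even, and contribute nothing. The lower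
    end of direction [j] gives [cube j]; all other ends form [cap j]. *)
Lemma half_cube_boundary (j : 'I_n) b :
  \sum_c half_cube j c * face b c = cap j b + cube j b.
Proof.
rewrite (box_boundary (side j)) (bigID (fun p : 'I_n => (p <= j)%N)) /=.
rewrite [X in _ + X]big1 ?addr0; last first.
  move=> p pj; rewrite (bigD1 p) //= eqxx big1 ?mul0r // => v _.
  rewrite /side ltnNge (leq_trans (leqnSn _)) 1?ltnNge //=.
  rewrite -ltnNge in pj; rewrite gtn_eqF // /vertex /inc -natrM mulnb.
  by rewrite [_ && _](_ : _ = false) //; apply/negP; lia.
rewrite /cap (bigD1 j) //= [X in _ = X + _](bigD1 j) //= addrAC.
congr (_ + _); last first.
  apply: eq_bigr => p /andP[pj pNj]; apply: eq_bigr => i _.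
  case: eqP => // ->; have pltj : (p < j)%N by rewrite ltn_neqAle pNj.
  by rewrite /side pltj edges_inc //; lia.
rewrite /cube !(bigD1 j (P := xpredT)) //= !eqxx ltnn add0r /side ltnn eqxx edges_inc; last first.
- by rewrite leqnn; lia.
- by lia.
- by lia.
rewrite mulrDl addrC; congr (_ * _ + _ * _).
  by apply: eq_bigr => i /negPf iNj; rewrite (inj_eq val_inj) iNj.
by apply: eq_bigr => i /negPf iNj; rewrite iNj.
Qed.

Lemma cube_split (j : 'I_n) c : cube j.+1 c = half_cube j c + half_cube j (neg c).
Proof.
rewrite /cube /half_cube !(bigD1 j (P := xpredT)) //= ltnSn /side ltnn eqxx.
rewrite [X in _ = _ + _ * X](eq_bigr (fun i => side j i (c i))) => [|i iNj]; last first.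
  rewrite /side ffunE (inj_eq val_inj) (negPf iNj) edges_rev // subnn subn0.
  by rewrite vertex_rev ?leq_addr // addnK.
rewrite -mulrDl; congr (_ * _); last first.
  apply: eq_bigr => i iNj.
  by rewrite /side (inj_eq val_inj) (negPf iNj) ltnS leq_eqVlt (inj_eq val_inj) (negPf iNj).
rewrite ffunE edges_rev // subnn addnK /edges -F2_addb; congr (nat_of_bool _)%:R.
by have := ltn_ord (c j) => ?; apply/idP/idP; lia.
Qed.

Lemma cube_neg j c : cube j (neg c) = cube j c.
Proof.
apply: eq_bigr => i _; rewrite ffunE edges_rev // subnn subn0.
by rewrite vertex_rev ?leq_addr // addnK.
Qed.

(** The two halves share the dividing [cube j], which is invariant under [neg] and so cancels. *)
Lemma cube_boundary (j : 'I_n) b :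
  \sum_c cube j.+1 c * face b c = cap j b + cap j (neg b).
Proof.
under eq_bigr do rewrite cube_split mulrDl.
rewrite big_split /= half_cube_boundary.
rewrite [X in _ + X](reindex_inj (can_inj negK)) /=.
under [X in _ + X]eq_bigr do rewrite negK -[b in face b]negK face_neg.
by rewrite half_cube_boundary cube_neg addrACA F2_addrr addr0.
Qed.

(** * Ky Fan's lemma for antipodal signs *)

Section Antipodal.
Variable s : cell -> bool.
Hypothesis s_neg : forall c, boundary_cell c -> s (neg c) = ~~ s c.

Lemma flag_neg j c : boundary_cell c -> flag s j (neg c) = flag s j c.
Proof.
elim: j c => [//|j IHj] c bdc /=.
rewrite (reindex_inj (can_inj negK)) /=; apply: eq_bigr => b _.
rewrite face_neg; have [->|/face_subcell bc] := eqVneq (face b c) 0; first by rewrite !mul0r.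
have bdb := subcell_boundary bc bdc.
by rewrite IHj // !s_neg // addNb addbN negbK.
Qed.

(** Stokes: a cocycle sums to zero over the boundary of [half_cube j]. *)
Lemma sum_cap (j : 'I_n) :
  \sum_b cap j b * flag s j b = \sum_b cube j b * flag s j b.
Proof.
have: \sum_b (cap j b + cube j b) * flag s j b = 0.
  under eq_bigr do rewrite -half_cube_boundary mulr_suml.
  rewrite exchange_big big1 //= => c _; under eq_bigr do rewrite -mulrA.
  by rewrite -mulr_sumr (flag_face s j).1 mulr0.
under eq_bigr do rewrite mulrDl; rewrite big_split /= => /eqP.
by rewrite addr_eq0 => /eqP->; rewrite oppr_pchar2 // pchar_Fp.
Qed.

(** Stokes again moves the coboundary [flag s j.+1] to [cap j] and its antipode, weighted by [s].
    Exactly one of [b], [neg b] has positive sign, so [cap j] is counted once. *)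
Lemma sum_cubeS (j : 'I_n) :
  \sum_c cube j.+1 c * flag s j.+1 c = \sum_b cube j b * flag s j b.
Proof.
rewrite -sum_cap.
transitivity (\sum_b (cap j b + cap j (neg b)) * ((s b)%:R * flag s j b)).
  under eq_bigr do rewrite (flag_face s j).2 mulr_sumr.
  rewrite exchange_big; apply: eq_bigr => b _ /=.
  by rewrite -cube_boundary mulr_suml; apply: eq_bigr => c _; rewrite mulrA.
under eq_bigr do rewrite mulrDl; rewrite big_split /=.
rewrite [X in _ + X](reindex_inj (can_inj negK)) /= -big_split /=.
apply: eq_bigr => b _; rewrite negK -mulrDr.
have [->|/cap_boundary bdb] := eqVneq (cap j b) 0; first by rewrite !mul0r.
by rewrite flag_neg // s_neg // -mulrDl -F2_addb addbN addbb mul1r.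
Qed.

Lemma sum_cube j : (j <= n)%N -> \sum_c cube j c * flag s j c = 1.
Proof.
elim: j => [_|j IHj jn]; last by rewrite (sum_cubeS (Ordinal jn)) IHj // ltnW.
(* [cube 0] is the central vertex alone. *)
under eq_bigr do rewrite mulr1.
have M_lt : (M < (M + M).+1)%N by lia.
rewrite (bigD1 [ffun => Ordinal M_lt]) //= [X in _ + X]big1 => [|c cM]; last first.
  have [i ciM] : exists i, c i != M :> nat.
    apply/existsP; apply: contraR cM; rewrite negb_exists => /forallP cM.
    apply/eqP/ffunP => i; apply/val_inj; rewrite ffunE /=; apply/eqP.
    by have := cM i; rewrite negbK.
  by rewrite /cube (bigD1 i) //= /vertex (negPf ciM) mul0r.
by rewrite addr0 /cube big1 // => i _; rewrite ffunE /vertex eqxx.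
Qed.

(** The total of [flag s j] over [cap j] is odd, so some alternating flag ends at a boundary cell;
    each of its [j] sign changes costs one unit of [rk]. *)
Lemma alternating_flag (rk : cell -> nat) (k j : nat) : (j < n)%N ->
  (forall c, boundary_cell c -> (rk c <= k)%N) ->
  (forall b c, subcell b c -> boundary_cell c -> (rk c + (s b (+) s c) <= rk b)%N) ->
  exists2 c, boundary_cell c & (rk c + j <= k)%N.
Proof.
move=> jn rk_le rk_sub.
have flag_rk i c : boundary_cell c -> flag s i c != 0 -> (rk c + i <= k)%N.
  elim: i c => [c bdc _|i IHi c bdc]; first by rewrite addn0 rk_le.
  apply: contraR => rk_gt; rewrite /= big1 // => b _; apply/eqP; apply: contraR rk_gt.
  rewrite !mulf_eq0 !negb_or => /and3P[/face_subcell bc sbc flagb].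
  have := IHi b (subcell_boundary bc bdc) flagb; have := rk_sub b c bc bdc.
  by case: (s b (+) s c) sbc; [lia|rewrite eqxx].
have [c capc] : exists c, cap j c * flag s j c != 0.
  apply/existsP; apply: contraT; rewrite negb_exists => /forallP cap0.
  have := sum_cube (ltnW jn); rewrite -(sum_cap (Ordinal jn)) big1 => [/eqP|c _].
    by rewrite eq_sym oner_eq0.
  by apply/eqP; rewrite -[_ == _]negbK.
move: capc; rewrite mulf_eq0 negb_or => /andP[/cap_boundary bdc flagc].
by exists c => //; apply: flag_rk.
Qed.

End Antipodal.
End Grid.

(** * Antipodal covers *)

Lemma subcell_refl n M (c : {ffun 'I_n -> 'I_(M + M).+1}) : subcell c c.
Proof. by apply/forallP => i; rewrite eqxx. Qed.

Lemma subcell_trans n M : transitive (@subcell n M).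
Proof.
move=> b a c /forallP ab /forallP bc; apply/forallP => i.
case/orP: (bc i) => [/eqP <-//|bci]; case/orP: (ab i) => [/eqP->|abi].
  by rewrite bci orbT.
by apply/orP; lia.
Qed.

Lemma subcell_neg n M (b c : {ffun 'I_n -> 'I_(M + M).+1}) : subcell b c -> subcell (neg b) (neg c).
Proof.
move=> /forallP bc; apply/forallP => i; rewrite !ffunE.
case/orP: (bc i) => [/eqP->|bci]; first by rewrite eqxx.
by have := (ltn_ord (b i), ltn_ord (c i)) => -[? ?]; apply/orP; right; rewrite /=; lia.
Qed.

Section Cover.
Variables (R : realType) (D k m : nat) (G : 'I_k -> set 'rV[R]_D.+1).
Hypothesis G_nbhs : forall i y, y != 0 -> G i y -> nbhs y (G i).
Hypothesis G_antipodal : forall i y, G i y -> ~ G i (- y).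
Hypothesis m_gt0 : (0 < m)%N.
Hypothesis G_mult : forall y, y != 0 -> (m <= #|[pred i : 'I_k | `[< G i y >]]|)%N.

Lemma lebesgue_number : exists2 e : R, 0 < e &
  forall y : 'rV[R]_D.+1, `|y| = 1 -> (m <= #|[pred i : 'I_k | `[< ball y e `<=` G i >]]|)%N.
Proof.
pose S := [set y : 'rV[R]_D.+1 | `|y| = 1].
have cptS : compact S.
  apply: bounded_closed_compact.
    by exists 1; split; [exact: real1|move=> x x1 y /= ->; exact: ltW].
  rewrite (_ : S = Num.norm @^-1` [set 1])//.
  by apply: preimage_closed => [y _|]; [exact: norm_continuous|exact: closed_eq].
have /compact_near_coveringP := cptS.
move=> /(_ R 0^'+ (fun e y => (m <= #|[pred i : 'I_k | `[< ball y e `<=` G i >]]|)%N)).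
case=> [y yS|e /= e0 eS].
  have y0 : y != 0 by rewrite -normr_gt0 yS ltr01.
  have [e e0 eG] : exists2 e : R, 0 < e & forall i, G i y -> ball y e `<=` G i.
    have : \forall z \near y, forall i, G i y -> G i z.
      apply: (@filter_forall _ 'I_k (fun i z => G i y -> G i z) (nbhs y) _) => i.
      have [Gi|nGi] := pselect (G i y); last exact: nearW.
      by apply: filterS (G_nbhs y0 Gi) => z Gz _.
    by case/nbhs_ballP => e /= e0 eG; exists e => // i Gi z /eG; exact.
  (* Half of the radius pays for moving the centre from [y] to [z]. *)
  exists (ball y (e / 2), [set x | x < e / 2]).
    by split; [apply: nbhsx_ballx; lra|apply: nbhs_right_lt; lra].
  move=> [z x] /= [yz xe]; apply: leq_trans (G_mult y0) _.
  apply/subset_leq_card/fintype.subsetP => i; rewrite !unfold_in => /asboolP Gi.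
  apply/asboolP => w zw.
  apply: (eG i Gi); rewrite [e]splitr; apply: ball_triangle yz _.
  exact: le_ball (ltW xe) _ zw.
exists (e / 2); first by rewrite divr_gt0.
by move=> y; apply: (eS (e / 2)) => /=; [rewrite sub0r normrN gtr0_norm; lra|lra].
Qed.

Section Labels.
Variables (M : nat) (e : R).
Hypotheses (M_gt0 : (0 < M)%N) (Me : M%:R^-1 < e).
Hypothesis G_ball : forall y : 'rV[R]_D.+1, `|y| = 1 ->
  (m <= #|[pred i : 'I_k | `[< ball y e `<=` G i >]]|)%N.
Notation cell := {ffun 'I_D.+1 -> 'I_(M + M).+1}.

(** The grid is scaled to the unit ball of the sup norm, with neighbouring values [1/M] apart. *)
Definition center (c : cell) : 'rV[R]_D.+1 := \row_i (((c i)%:R - M%:R) / M%:R).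

Lemma center_neg c : center (neg c) = - center c.
Proof.
apply/rowP => i; rewrite !mxE ffunE /= subSS -mulNr; congr (_ / _).
by rewrite natrB ?natrD; [lra|have := ltn_ord (c i); lia].
Qed.

Lemma center_norm c : boundary_cell c -> `|center c| = 1.
Proof.
move=> /existsP[p cp]; have M0 : 0 < M%:R :> R by rewrite ltr0n.
apply/eqP; rewrite eq_le; apply/andP; split.
  rewrite [leLHS]/Num.norm /= mx_normrE; apply/bigmax_leP; split=> //= -[i j] _ /=.
  rewrite mxE normrM normfV (gtr0_norm M0) ler_pdivrMr // mul1r ler_norml.
  have : (c j)%:R <= M%:R + M%:R :> R by rewrite -natrD ler_nat -ltnS.
  by have : 0 <= (c j)%:R :> R by []; lra.
rewrite [leRHS]/Num.norm /= mx_normrE; apply/bigmax_geP; right => /=.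
exists (ord0, p) => //=; rewrite mxE normrM normfV (gtr0_norm M0) ler_pdivlMr // mul1r.
case/orP: cp => /eqP->; first by rewrite sub0r normrN ger0_norm // ltW.
by rewrite natrD addrK ger0_norm // ltW.
Qed.

Lemma center_sub b c : subcell b c -> ball (center c) e (center b).
Proof.
move=> /forallP bc; have M0 : 0 < M%:R :> R by rewrite ltr0n.
have e0 : 0 < e by apply: lt_trans Me; rewrite invr_gt0.
split=> // i j; rewrite !mxE /ball /= -mulrBl normrM normfV (gtr0_norm M0).
apply: le_lt_trans Me; rewrite ler_pdivrMr // mulVf ?gt_eqF //.
rewrite ler_norml; case/orP: (bc j) => [/eqP->|/andP[_ /orP[]/eqP->]].
- by lra.
- by rewrite -natr1; lra.
- by rewrite -natr1; lra.
Qed.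

(** The centres of all subcells stand in for the whole cell; this makes labels grow on passing to a
    subcell. *)
Definition label (c : cell) : {set 'I_k} :=
  [set i | `[< forall b, subcell b c -> G i (center b) >]]%SET.

Lemma label_sub b c : subcell b c -> label c \subset label b.
Proof.
move=> bc; apply/fintype.subsetP => i; rewrite !finset.in_set => /asboolP Gi.
by apply/asboolP => a ab; apply: Gi; apply: subcell_trans ab bc.
Qed.

Lemma label_disjoint c : label c :&: label (neg c) = finset.set0.
Proof.
apply/setP => i; rewrite finset.in_setI !finset.in_set.
apply/negP => /andP[/asboolP Gi /asboolP Gi'].
have := Gi' _ (subcell_refl _); rewrite center_neg; apply: G_antipodal.
exact: Gi (subcell_refl _).
Qed.

Lemma label_card c : boundary_cell c -> (m <= #|label c|)%N.
Proof.
move=> bdc; apply: leq_trans (G_ball (center_norm bdc)) _.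
apply/subset_leq_card/fintype.subsetP => i; rewrite finset.in_set unfold_in => /asboolP Gi.
by apply/asboolP => b bc; apply/Gi/center_sub.
Qed.

Definition rank c := (#|label c| + #|label (neg c)|)%N.

Lemma rankE c : rank c = #|label c :|: label (neg c)|.
Proof. by rewrite /rank cardsU label_disjoint cards0 subn0. Qed.

(** The picked index depends only on a union invariant under [neg], so [c] and [neg c] pick the same
    one, and it lies in exactly one of their disjoint labels. *)
Definition sign c :=
  if [pick i in label c :|: label (neg c)] is Some i then i \in label c else false.

Lemma sign_neg c : boundary_cell c -> sign (neg c) = ~~ sign c.
Proof.
move=> bdc; rewrite /sign negK [label (neg c) :|: _]finset.setUC.
case: pickP => [i|none].
  have := finset.in_set0 i; rewrite -(label_disjoint c) finset.in_setI finset.in_setU.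
  by case: (i \in label c); case: (i \in label _).
have := label_card bdc; rewrite leqNgt (_ : #|_| = 0)%N ?m_gt0 //.
by apply: eq_card0 => i; have := none i; rewrite finset.in_setU => /norP[/negPf].
Qed.

(** Both labels can only grow on a subcell. If neither does, the signs agree, as they are determined
    by the two labels. *)
Lemma rank_sub b c : subcell b c -> (rank c + (sign b (+) sign c) <= rank b)%N.
Proof.
move=> bc; have [sub1 sub2] := (label_sub bc, label_sub (subcell_neg bc)).
have [le1 le2] := (subset_leqif_cards sub1, subset_leqif_cards sub2).
have := (le1.2, le2.2, le1.1, le2.1) => -[[[eq1 eq2] {}le1] {}le2].
have bit_le1 := leq_b1 (sign b (+) sign c); rewrite /rank.
case: eqVneq eq1 => [_ /esym/eqP eq1|ne1 _]; last by lia.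
case: eqVneq eq2 => [_ /esym/eqP eq2|ne2 _]; last by lia.
by rewrite /sign eq1 eq2 addbb addn0.
Qed.

Lemma even_cubical_cover : ~~ odd M -> (D + 2 * m <= k)%N.
Proof.
move=> evenM.
have [c bdc rk_le] : exists2 c, boundary_cell c & (rank c + D <= k)%N.
  apply: (alternating_flag evenM sign_neg) => // [c _|b c bc _].
    by rewrite rankE -[X in (_ <= X)%N]card_ord max_card.
  exact: rank_sub.
have := label_card bdc; have := label_card (etrans (boundary_neg c) bdc).
by rewrite /rank in rk_le; lia.
Qed.

End Labels.

(* Multiple Lusternik-Schnirelmann theorem, with the sphere replaced by the nonzero vectors. *)
Lemma antipodal_cover_bound : (D + 2 * m <= k)%N.
Proof.
have [e e0 G_ball] := lebesgue_number.
(* [N] exceeds [1/e]; doubling it makes the grid size even. *)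
pose N := (Num.bound e^-1).+1.
apply: (@even_cubical_cover (N + N) e) => //; last by lia.
rewrite -[e]invrK ltf_pV2 ?posrE ?invr_gt0 ?ltr0n ?addn_gt0 //.
apply: lt_le_trans (archi_boundP _) _; first by rewrite invr_ge0 ltW.
by rewrite ler_nat; lia.
Qed.

End Cover.

(** * Radial projection and restriction to the equator *)

Definition sqnorm (R : realType) n (x : 'rV[R]_n) : R := \sum_i x ord0 i ^+ 2.

Lemma sqnorm_ge0 (R : realType) n (x : 'rV[R]_n) : 0 <= sqnorm x.
Proof. by apply: sumr_ge0 => i _; apply: sqr_ge0. Qed.

Lemma sqnorm_gt0 (R : realType) n (x : 'rV[R]_n) : x != 0 -> 0 < sqnorm x.
Proof.
move=> x0; rewrite lt_neqAle sqnorm_ge0 andbT eq_sym; apply: contraNneq x0.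
move=> /eqP; rewrite psumr_eq0 => [/allP x0|i _]; last exact: sqr_ge0.
apply/eqP/rowP => i; rewrite mxE; apply/eqP.
by rewrite -sqrf_eq0; apply: x0 (mem_index_enum i).
Qed.

Definition normalize (R : realType) n (x : 'rV[R]_n) := (Num.sqrt (sqnorm x))^-1 *: x.

Lemma normalize_sphere (R : realType) n (x : 'rV[R]_n.+1) :
  x != 0 -> sphere (normalize x).
Proof.
move=> /sqnorm_gt0 x0; rewrite /sphere /=.
under eq_bigr do rewrite mxE exprMn exprVn sqr_sqrtr ?sqnorm_ge0 //.
by rewrite -mulr_sumr mulVf ?gt_eqF.
Qed.

Lemma normalizeN (R : realType) n (x : 'rV[R]_n) : normalize (- x) = - normalize x.
Proof.
rewrite /normalize scalerN (_ : sqnorm (- x) = sqnorm x) //.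
by apply: eq_bigr => i _; rewrite mxE sqrrN.
Qed.

Lemma continuous_normalize (R : realType) n (x : 'rV[R]_n.+1) :
  x != 0 -> {for x, continuous (@normalize R n.+1)}.
Proof.
move=> /sqnorm_gt0 x0.
have sq : sqnorm z @[z --> x] --> sqnorm x.
  apply: (cvg_big add_continuous) => [|i _]; first exact: nbhs_filter.
  apply: (@continuous_comp _ _ _ (fun z : 'rV[R]_n.+1 => z ord0 i) (fun r => r ^+ 2)).
    exact: coord_continuous.
  exact: exprn_continuous.
have sqrt_sq : Num.sqrt (sqnorm z) @[z --> x] --> Num.sqrt (sqnorm x).
  by apply: continuous_cvg sq; apply: sqrt_continuous.
have sqrt0 : Num.sqrt (sqnorm x) != 0 by rewrite gt_eqF // sqrtr_gt0.
exact: (cvgZ (cvgV sqrt0 sqrt_sq) cvg_id).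
Qed.

Definition equator_emb (R : realType) n (y : 'rV[R]_n) : 'rV[R]_n.+1 :=
  \row_i oapp (y ord0) 0 (unlift ord_max i).

Lemma continuous_equator_emb (R : realType) n : continuous (@equator_emb R n.+1).
Proof.
move=> y A /nbhs_ballP[e /= e0 eA]; apply/nbhs_ballP; exists e => //= z [_ yz].
apply: eA; split=> // i j; rewrite !mxE; case: unliftP => [j' _|_] /=; first exact: yz.
exact: ballxx.
Qed.

Lemma equator_emb_neq0 (R : realType) n (y : 'rV[R]_n) : y != 0 -> equator_emb y != 0.
Proof.
apply: contraNneq => /rowP y0; apply/eqP/rowP => i.
by have := y0 (lift ord_max i); rewrite !mxE liftK.
Qed.

Lemma equator_embN (R : realType) n (y : 'rV[R]_n) : equator_emb (- y) = - equator_emb y.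
Proof. by apply/rowP => i; rewrite !mxE; case: unlift => [j|] /=; rewrite ?mxE ?oppr0. Qed.

Lemma multE (R : realType) (d k : nat) (F : 'I_k -> set 'rV[R]_d.+1) x :
  mult F x = #|[pred i | `[< F i x >]]|.
Proof. by apply: eq_card => i; rewrite unfold_in; apply/idP/idP => [/set_mem|/mem_set]. Qed.

(** The equator lies in the closed northern hemisphere, hence is covered [m] times. Radial
    projection extends the sets to all nonzero vectors. *)
Lemma equator_cover_bound (R : realType) (d n m k : nat)
    (F : 'I_k -> set 'rV[R]_(d.+2)) :
  (0 < m)%N -> antipodal_nm_open_cover n m F -> (d + 2 * m <= k)%N.
Proof.
move=> m_gt0 [F_open F_sphere F_anti _ F_north].
pose G i (y : 'rV[R]_d.+1) := F i (normalize (equator_emb y)).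
apply: (@antipodal_cover_bound R d k m G) => // [i y y0|i y|y y0].
- rewrite /G; have [U [U_open ->]] := F_open i => -[Uy _].
  have Cy : normalize (equator_emb z) @[z --> y] --> normalize (equator_emb y).
    apply: continuous_comp; first exact: continuous_equator_emb.
    exact/continuous_normalize/equator_emb_neq0.
  have near_U : nbhs y [set z | U (normalize (equator_emb z))].
    exact: Cy (open_nbhs_nbhs (conj U_open Uy)).
  have near_neq0 : nbhs y [set z | z != 0].
    apply/nbhs_ballP; exists `|y|; first by rewrite /= normr_gt0.
    move=> z; rewrite -ball_normE /ball_ /=; apply: contraTneq => ->.
    by rewrite subr0 ltxx.
  apply: filterS (filterI near_U near_neq0) => z [Uz z0].
  by split=> //; apply/normalize_sphere/equator_emb_neq0.
- by move=> /F_anti; rewrite -normalizeN -equator_embN.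
- rewrite -multE; apply: F_north; split; first exact/normalize_sphere/equator_emb_neq0.
  by rewrite !mxE unlift_none /= mulr0.
Qed.

(** * Gale's lemma and the construction *)

(** The leading terms of [q] and its shift cancel. *)
Lemma size_poly_difference (R : idomainType) (q : {poly R}) n :
  (size q <= n.+1)%N -> (size (q \Po ('X + 1) - q)%R <= n)%N.
Proof.
move=> qn; have sizeX1 : size ('X + 1 : {poly R}) = 2%N by rewrite -[1]polyC1 size_XaddC.
have size_comp : size (q \Po ('X + 1)) = size q by rewrite size_comp_poly2.
apply/leq_sizeP => j; rewrite leq_eqVlt coefB => /orP[/eqP<-|nj]; last first.
  by rewrite !nth_default ?subr0 ?size_comp //; apply: leq_trans qn nj.
move: qn; rewrite leq_eqVlt => /orP[/eqP qn1|qn1]; last first.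
  by rewrite !nth_default ?subr0 ?size_comp.
have := @lead_coef_comp _ q ('X + 1); rewrite sizeX1 => /(_ isT).
rewrite !lead_coefE size_comp qn1 sizeX1 /= coefD coefX coef1 addr0 expr1n mulr1.
by move=> ->; rewrite subrr.
Qed.

(** Pascal's rule reduces the sum, up to sign, to one of lower order for [q(X + 1) - q]. *)
Lemma finite_difference (R : idomainType) n (q : {poly R}) : (size q <= n)%N ->
  \sum_(i < n.+1) (-1) ^+ i * q.[i%:R] *+ 'C(n, i) = 0.
Proof.
elim: n q => [|n IHn] q.
  by rewrite leqn0 size_poly_eq0 => /eqP->; rewrite big1 // => i _; rewrite horner0 mulr0 mul0rn.
move=> qn; pose a i := (-1) ^+ i * q.[i%:R].
transitivity (\sum_(i < n.+2) a i *+ 'C(n, i) + \sum_(i < n.+1) a i.+1 *+ 'C(n, i)).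
  rewrite !(big_ord_recl n.+1) /= !bin0 -addrA -big_split; congr (_ + _).
  by apply: eq_bigr => i _; rewrite /bump /= add1n binS mulrnDr.
rewrite big_ord_recr /= bin_small // mulr0n addr0 -big_split /=.
have IH := IHn _ (size_poly_difference qn).
rewrite -[RHS]oppr0 -[X in _ = - X]IH -sumrN; apply: eq_bigr => i _.
rewrite hornerD hornerN horner_comp hornerD hornerX hornerE natr1 -mulrnDl -mulNrn.
by congr (_ *+ _); rewrite /a exprS; ring.
Qed.

(** The vanishing [n]-th difference is a sum of nonnegative terms, so [q] has the [n + 1] roots
    [0, ..., n], too many for its degree. *)
Lemma weakly_alternating_poly (R : realFieldType) n (q : {poly R}) : (size q <= n)%N ->
  (forall i, (i <= n)%N -> 0 <= (-1) ^+ i * q.[i%:R]) -> q = 0.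
Proof.
move=> qn q_ge0; apply/eqP; apply: contraT => q0.
have roots : all (root q) [seq i%:R | i <- iota 0 n.+1].
  apply/allP => x /mapP[i]; rewrite mem_iota add0n => /= i_le ->.
  have := finite_difference qn => /eqP.
  rewrite psumr_eq0 => [/allP/(_ (Ordinal i_le) (mem_index_enum _)) /=|j _].
    by rewrite mulrn_eq0 mulf_eq0 signr_eq0 -leqn0 leqNgt bin_gt0 -ltnS i_le.
  by rewrite mulrn_wge0 // q_ge0 // -ltnS.
have := max_poly_roots q0 roots; rewrite map_inj_uniq ?iota_uniq => [/(_ isT)|]; last first.
  by move=> i j /eqP; rewrite eqr_nat => /eqP.
by rewrite size_map size_iota ltnNge (leq_trans qn).
Qed.

(* Multiplying [p] by [('X - c)^2 - 1/4] changes its sign at the integer [c] only; doing so at each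
   index counted below would make a polynomial of too small a degree weakly alternating. *)
Lemma gale_poly (R : realFieldType) (d m k : nat) (p : {poly R}) :
  k.+1 = (d + 2 * m)%N -> p != 0 -> (size p <= d.+1)%N ->
  (m <= #|[pred i : 'I_k.+1 | (0 < (-1) ^+ i.+1 * p.[i%:R])%R]|)%N.
Proof.
move=> km p0 pd; set A := [pred i | _]; rewrite leqNgt; apply/negP => Am.
pose f (c : 'I_k.+1) : {poly R} := ('X - c%:R%:P) ^+ 2 - 4^-1%:P.
have size_f c : size (f c) = 3%N.
  rewrite /f size_polyDl size_exp_XsubC //.
  by rewrite size_polyN (leq_ltn_trans (size_polyC_leq1 _)).
have f_neq0 c : f c != 0 by rewrite -size_poly_eq0 size_f.
have f_eq c (i : 'I_k.+1) : i = c -> (f c).[i%:R] < 0.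
  by move=> ->; rewrite /f !hornerE subrr; lra.
have f_neq c (i : 'I_k.+1) : i != c -> 0 < (f c).[i%:R].
  move=> ic; rewrite /f !hornerE.
  have : (i < c)%N || (c < i)%N by rewrite -neq_ltn.
  by case/orP; rewrite -(ler_nat R) -natr1 => ?; nra.
pose q := p * \prod_(c in A) f c.
have q0 : q = 0.
  (* Each factor raises the degree by 2 and [A] has at most [m - 1] elements, so [q] has size at
     most [d + 2m - 1 = k]. *)
  apply: (@weakly_alternating_poly _ k) => [|i ik].
    apply: leq_trans (size_polyMleq _ _) _.
    have : (size (\prod_(c in A) f c)%R <= (\sum_(c in A) size (f c)).+1 - #|A|)%N.
      exact: size_poly_prod_leq.
    have -> : (\sum_(c in A) size (f c) = #|A| * 3)%N.
      by rewrite (eq_bigr (fun=> 3%N)) // sum_nat_const.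
    by lia.
  rewrite -ltnS in ik; rewrite -[i]/(val (Ordinal ik)); move: (Ordinal ik) => {ik}i.
  rewrite hornerM mulrA horner_prod.
  (* Outside [A] the sign of [p] is already right and all factors are positive; in [A] it is wrong
     and the factor [f i] corrects it. *)
  case: (boolP (i \in A)) => iA; last first.
    apply: mulr_ge0; last first.
      apply: prodr_ge0 => c cA; apply/ltW/(f_neq c i).
      by apply: contraNneq iA => ->.
    by move: iA; rewrite inE /= exprS mulN1r mulNr oppr_gt0 -leNgt.
  rewrite (bigD1 i) //= mulrA; apply: mulr_ge0; last first.
    by apply: prodr_ge0 => c /andP[_ ci]; apply/ltW/(f_neq c i); rewrite eq_sym.
  move: iA; rewrite inE /= exprS mulN1r mulNr oppr_gt0 => iA.
  by rewrite mulr_le0 ?ltW ?f_eq.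
move/eqP: q0; rewrite mulf_eq0 (negPf p0) /= prodf_seq_eq0 => /hasP[c _].
by rewrite (negPf (f_neq0 c)) andbF.
Qed.

Section Construction.
Variables (R : realType) (d : nat).

(** Reversing the coordinates makes the last one the constant term, the value at 0. *)
Definition row_poly (x : 'rV[R]_d.+1) : {poly R} := rVpoly (\row_j x ord0 (rev_ord j)).

Lemma row_poly_horner x t : (row_poly x).[t] = \sum_(j < d.+1) x ord0 (rev_ord j) * t ^+ j.
Proof.
rewrite (horner_coef_wide _ (size_poly _ _)); apply: eq_bigr => j _.
by rewrite coef_rVpoly_ord mxE.
Qed.

Lemma row_poly_neq0 x : sphere x -> row_poly x != 0.
Proof.
rewrite /sphere /= => x1; apply/eqP => px0.
have x0 i : x ord0 i = 0.
  have := congr1 (fun p : {poly R} => p`_(rev_ord i)) px0.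
  by rewrite coef_rVpoly_ord mxE rev_ordK coef0.
have /eqP := x1; rewrite big1 => [|i _]; first by rewrite eq_sym oner_eq0.
by rewrite x0 expr0n.
Qed.

(** Set [i] tests the integer [i + 1], so Gale's sign [(-1)^((i+1)+1)] becomes [(-1)^i]. *)
Definition gale_set (i : nat) : set 'rV[R]_d.+1 :=
  [set x | 0 < (-1) ^+ i * (row_poly x).[i.+1%:R]] `&` @sphere R d.

Lemma gale_set_open i : open_in_sphere (gale_set i).
Proof.
exists [set x | 0 < (-1) ^+ i * (row_poly x).[i.+1%:R]]; split=> //.
apply: (@open_comp _ _ (fun x => (-1) ^+ i * (row_poly x).[i.+1%:R]) [set r | 0 < r]).
  move=> x _; apply: (@continuous_comp _ _ _ (fun z => (row_poly z).[i.+1%:R])); last first.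
    exact: mulrl_continuous.
  have -> : (fun z => (row_poly z).[i.+1%:R]) =
      (fun z => \sum_(j < d.+1) z ord0 (rev_ord j) * i.+1%:R ^+ j).
    by apply/funext => z; rewrite row_poly_horner.
  apply: (cvg_big add_continuous) => [|j _]; first exact: nbhs_filter.
  apply: (@continuous_comp _ _ _ (fun z : 'rV[R]_d.+1 => z ord0 (rev_ord j))
    ( *%R^~ (i.+1%:R ^+ j))).
    exact: coord_continuous.
  exact: mulrr_continuous.
exact: open_gt.
Qed.

Lemma gale_set_antipodal i x : gale_set i x -> ~ gale_set i (- x).
Proof.
move=> [px _] [pNx _]; move: px pNx => /=.
have -> : (row_poly (- x)).[i.+1%:R] = - (row_poly x).[i.+1%:R].
  by rewrite !row_poly_horner -sumrN; apply: eq_bigr => j _; rewrite mxE mulNr.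
by rewrite mulrN oppr_gt0 => px /(lt_trans px); rewrite ltxx.
Qed.

(* The index [0] omitted from the sets [gale_set] would contribute the southern hemisphere. *)
Lemma gale_set_mult m k (x : 'rV[R]_d.+1) : k.+1 = (d + 2 * m)%N -> sphere x ->
  (m <= (x ord0 ord_max < 0)%R + mult (fun i : 'I_k => gale_set i) x)%N.
Proof.
move=> km Sx; apply: leq_trans (gale_poly km (row_poly_neq0 Sx) (size_poly _ _)) _.
apply: eq_leq; rewrite multE -!sum1_card big_mkcond big_ord_recl /=; congr (_ + _)%N.
  rewrite inE /= row_poly_horner big_ord_recl big1 => [|j _]; last by rewrite expr0n mulr0.
  rewrite expr1 mulN1r mulr1 addr0 oppr_gt0 (_ : rev_ord ord0 = ord_max); first by case: ifP.
  by apply: val_inj; rewrite /= subn1.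
rewrite [RHS]big_mkcond; apply: eq_bigr => i _.
rewrite !inE /= /bump add1n exprS exprS mulrA mulrNN mul1r mul1r.
by congr (if _ then _ else _); apply/idP/asboolP => [|[]].
Qed.

End Construction.

(* fbar(d,n,m) = d + 2m - 1: such a cover with d+2m-1 sets exists, and every
   such cover has at least d+2m-1 sets. *)
Theorem theorem3 (R : realType) (d n m : nat) :
  (1 <= d)%N -> (1 <= n)%N -> (n < m)%N ->
  (exists F : 'I_(d + 2 * m - 1) -> set 'rV[R]_(d.+1),
      @antipodal_nm_open_cover R d n m _ F) /\
  (forall (k : nat) (F : 'I_k -> set 'rV[R]_(d.+1)),
      @antipodal_nm_open_cover R d n m _ F -> (d + 2 * m - 1 <= k)%N).
Proof.
move=> d_gt0 _ nm; split=> [|k F coverF]; last first.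
  (* The equator has dimension one less, which accounts for the [- 1]. *)
  case: d d_gt0 => // d _ in F coverF *.
  by rewrite addSn subn1; apply: equator_cover_bound coverF; apply: leq_ltn_trans nm.
have km : (d + 2 * m - 1).+1 = (d + 2 * m)%N by lia.
exists (fun i => gale_set i); split=> [i|i x []//|i x|x Sx|x [Sx x_ge0]].
- exact: gale_set_open.
- exact: gale_set_antipodal.
(* The omitted index costs at most one, and [m - 1 >= n]. *)
- by have := gale_set_mult km Sx; case: (_ < _) => /=; lia.
- by have := gale_set_mult km Sx; rewrite ltNge x_ge0.
Qed.
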